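(* Let $p>1$ be a real number, let $a_j=j^p$ for $j\ge 1$, and let $J_p$ be the infinite Jacobi matrix with zero diagonal and off-diagonal entries $a_1,a_2,a_3,\dots$. Then the elements $A,B,C,D$ of the Nevanlinna matrix of the (indeterminate) Hamburger moment problem corresponding to $J_p$ have type \[ \frac12\,\mathrm{B}\!\left(\frac1{2p},\,1-\frac1p\right) \] with respect to the order $1/p$, where $\mathrm{B}(\cdot,\cdot)$ is the Euler beta function.
   Context: The matrix is \[ J_p=\begin{pmatrix}0&a_1&0&\cdots\\ a_1&0&a_2&\cdots\\ 0&a_2&0&\cdots\\ \vdots&\vdots&\vdots&\ddots\end{pmatrix},\qquad a_j=j^p .\] It is well known that for $p>1$ the corresponding Hamburger moment problem is indeterminate. Nevanlinna matrix: let $P_k$ and $Q_k$ ($k\ge0$) be the polynomials of the first and second kind associated with $J_p$. That is, $P_0=1$, $zP_0(z)=a_1P_1(z)$, $zP_k(z)=a_{k+1}P_{k+1}(z)+a_kP_{k-1}(z)$ for $k\ge1$; and $Q_0=0$, $Q_1=1/a_1$, $zQ_k(z)=a_{k+1}Q_{k+1}(z)+a_kQ_{k-1}(z)$ for $k\ge1$. The elements of the Nevanlinna matrix are the entire functions \[ A(z)=z\sum_{k\ge0}Q_k(0)Q_k(z),\qquad B(z)=-1+z\sum_{k\ge0}Q_k(0)P_k(z), \] \[ C(z)=1+z\sum_{k\ge0}P_k(0)Q_k(z),\qquad D(z)=z\sum_{k\ge0}P_k(0)P_k(z). \] The type of an entire function $f$ with respect to the order $\rho>0$ is $\limsup_{r\to\infty}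 r^{-\rho}\ln\max_{|z|=r}|f(z)|$. *)

(* Defs.v *)
From HB Require Import structures.
From mathcomp Require Import all_boot all_order all_algebra.
From mathcomp Require Import all_classical all_reals all_analysis.
From mathcomp Require Import complex.
Set Implicit Arguments.
Unset Strict Implicit.
Unset Printing Implicit Defensive.
Import Order.TTheory GRing.Theory Num.Theory numFieldNormedType.Exports.
Local Open Scope classical_set_scope.
Local Open Scope ring_scope.
Local Open Scope complex_scope.

(* A Jacobi matrix with zero diagonal is given by its off-diagonal sequence
   [a]; only the entries [a j] with [1 <= j] are meaningful. *)
Section JacobiPolynomials.
Context {R : realType}.
Variable a : nat -> R.

Fixpoint jacobiP (k : nat) : {poly R[i]} :=
  match k with
  | 0 => 1
  | k1.+1 =>
    ((a k1.+1)%:C)^-1 *: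
      match k1 with
      | 0 => 'X
      | k2.+1 => 'X * jacobiP k1 - (a k1)%:C *: jacobiP k2
      end
  end.

Fixpoint jacobiQ (k : nat) : {poly R[i]} :=
  match k with
  | 0 => 0
  | k1.+1 =>
    ((a k1.+1)%:C)^-1 *:
      match k1 with
      | 0 => 1
      | k2.+1 => 'X * jacobiQ k1 - (a k1)%:C *: jacobiQ k2
      end
  end.

(* The ascription to [R[i]^o] gives the summands the topology of the norm
   on [R[i]]. *)
Definition nevanlinnaA (z : R[i]) : R[i] :=
  z * limn (series (fun k => (jacobiQ k).[0] * (jacobiQ k).[z] : R[i]^o)).
Definition nevanlinnaB (z : R[i]) : R[i] :=
  -1 + z * limn (series (fun k => (jacobiQ k).[0] * (jacobiP k).[z] : R[i]^o)).
Definition nevanlinnaC (z : R[i]) : R[i] :=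
  1 + z * limn (series (fun k => (jacobiP k).[0] * (jacobiQ k).[z] : R[i]^o)).
Definition nevanlinnaD (z : R[i]) : R[i] :=
  z * limn (series (fun k => (jacobiP k).[0] * (jacobiP k).[z] : R[i]^o)).

End JacobiPolynomials.

(* For an entire [f] the supremum over the circle is the maximum. *)
Definition max_modulus {R : realType} (f : R[i] -> R[i]) (r : R) : \bar R :=
  ereal_sup [set (Normc.normc (f z))%:E | z in [set z | Normc.normc z = r]].

Definition exp_type {R : realType} (rho : R) (f : R[i] -> R[i]) : \bar R :=
  limf_esup (fun r : R => (r `^ (- rho))%:E * lne (max_modulus f r))%E +oo%R.

(* The library's [beta_fun] only takes natural parameters. *)
Definition euler_beta {R : realType} (x y : R) : R :=
  \int[lebesgue_measure]_(t in `]0, 1[) (t `^ (x - 1) * (1 - t) `^ (y - 1)).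

(* Main.v *)
Require Import Defs.
From mathcomp Require Import all_boot all_order all_algebra.
From mathcomp Require Import all_classical all_reals all_analysis.
From mathcomp Require Import measurable_realfun.
From mathcomp Require Import complex ring lra zify.

(** For [y > 0] the values at [z = i y] of the polynomials of the first and second
kind are, up to powers of [i], the solutions of
[a_(k+1) f_(k+1) = y f_k + a_k f_(k-1)], a recurrence with positive coefficients.
By the triangle inequality these solutions bound the polynomials on the whole
circle [|z| = y], and the terms of each of the four series have a common
argument at [i y]. The maximum modulus is therefore attained at [i y]
([max_modulus_nev]), and by a Christoffel-Darboux identity ([wr_sum]) it is the
limit of the increasing sequence of Casoratians of a solution at spectral
parameter [0] and a solution at spectral parameter [y].

Put [lam_j = exp (arcsinh (y / (2 j^p)))], so that
[j^p (lam_j - 1 / lam_j) = y]. A discrete WKB argument shows that solutions are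
bounded above by the product [Lam] of the [lam_j] ([jsol_le]) and below by the
same product up to a polynomial factor ([jsol_ge]), because [j^p lam_j]
increases with [j]. For indices beyond [y^(1/(p-1))] the Casoratians grow only
by a bounded factor ([wr_upper], [wr_upper_pw]). So the logarithm of the
maximum modulus is the sum of the [ln lam_j] up to [O(ln y)].

This sum is compared with [y^(1/p)] times half the beta integral as follows.
Each [ln lam_j] is half the integral of [dt / t] over [lam_j^-2 <= t < 1], and
[lam_j^-2 <= t] holds exactly when
[j <= y^(1/p) t^(1/(2p)) (1-t)^(-1/p)] ([tau_le]). The sum is thus half the
integral of a counting function divided by [t]. Bounding the number of positive
integers below a given real by this real gives the upper estimate
([ln_Lam_le]), and Fatou's lemma along [y = n^p] gives the lower one
([lam_avg_ge]). *)

Set Implicit Arguments.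
Unset Strict Implicit.
Unset Printing Implicit Defensive.
Import Order.TTheory GRing.Theory Num.Theory numFieldNormedType.Exports.
Local Open Scope classical_set_scope.
Local Open Scope ring_scope.

(** * Solutions of the recurrence on the imaginary axis *)

Section lam.
Context {R : realType}.
Implicit Types x y z : R.

(** For [x = 2 sinh u] this is [exp u]: the growth rate of the solutions of the
    recurrence with constant coefficients [f_(k+1) = x f_k + f_(k-1)]. *)
Definition lam x : R := (x + Num.sqrt (x ^+ 2 + 4)) / 2.

Lemma lam_gt0 x : 0 < lam x.
Proof.
rewrite divr_gt0// -ltrBlDl sub0r (le_lt_trans (ler_norm _))// normrN.
by rewrite -sqrtr_sqr ltr_sqrt ?ltrDl// ltr_wpDl ?sqr_ge0.
Qed.

Lemma lam_sqr x : lam x ^+ 2 = x * lam x + 1.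
Proof.
have h : 0 <= x ^+ 2 + 4 by rewrite addr_ge0// sqr_ge0.
by rewrite /lam; have := sqr_sqrtr h; set s := Num.sqrt _ => hs; lra.
Qed.

Lemma lamV x : (lam x)^-1 = lam x - x.
Proof.
have l0 := lt0r_neq0 (lam_gt0 x).
apply: (mulfI l0); rewrite mulfV// mulrBr -expr2 lam_sqr; ring.
Qed.

Lemma lam_le x : 0 <= x -> lam x <= x + 1.
Proof.
move=> x0; rewrite ler_pdivrMr// -lerBrDl.
rewrite -(@ler_pXn2r _ 2)// ?nnegrE ?sqrtr_ge0//; last lra.
rewrite sqr_sqrtr; last by rewrite addr_ge0// sqr_ge0.
nra.
Qed.

(** [lam] is the inverse of the increasing bijection [l |-> l - 1/l] from the
    positive reals to the reals, because [lam x - 1 / lam x = x]. *)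
Lemma le_lam x m : 0 < m -> (m <= lam x) = (m - m^-1 <= x).
Proof.
move=> m0; have l0 := lam_gt0 x; have := lamV x => h.
have [ml|lm] := leP m (lam x).
  have : (lam x)^-1 <= m^-1 by rewrite lef_pV2.
  by move=> h'; apply/esym; lra.
have : m^-1 < (lam x)^-1 by rewrite ltf_pV2.
by move=> h'; apply/esym/negbTE; rewrite -ltNge; lra.
Qed.

Lemma lam_mono x y : x <= y -> lam x <= lam y.
Proof.
by move=> xy; rewrite le_lam ?lam_gt0//; have := lamV x; lra.
Qed.

Lemma lam_ge1 x : 0 <= x -> 1 <= lam x.
Proof. by move=> x0; rewrite le_lam// invr1 subrr. Qed.

(** [c lam (y / c) = y + c / lam (y / c)], and both [c] and [1 / lam (y / c)]
    increase with [c]. *)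
Lemma lam_mulr_mono y a b : 0 <= y -> 0 < a -> a <= b ->
  a * lam (y / a) <= b * lam (y / b).
Proof.
move=> y0 a0 ab; have b0 : 0 < b by lra.
have E c : 0 < c -> c * lam (y / c) = y + c * (lam (y / c))^-1.
  by move=> c0; rewrite lamV; field; lra.
rewrite !E// lerD2l ler_pM ?invr_ge0 ?(ltW (lam_gt0 _)) ?(ltW a0)//.
rewrite lef_pV2 ?posrE ?lam_gt0//; apply: lam_mono.
by rewrite ler_wpM2l// lef_pV2.
Qed.

End lam.

Section real_rec.
Context {R : realType}.
Variable a : nat -> R.
Hypothesis a_gt0 : forall k, 0 < a k.+1.
Hypothesis a1 : a 1 = 1.
Hypothesis a_mono : forall k, a k.+1 <= a k.+2.

(** On the imaginary axis [z = i y] the three-term recurrence becomes, up to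
    powers of [i], the recurrence [a_(k+1) f_(k+1) = y f_k + a_k f_(k-1)], which
    has nonnegative coefficients for [y >= 0]. The initial data [(c, d)] are
    [(1, 0)] for the first kind and [(0, 1)] for the second kind; the value at
    index 1 is the one given by the recurrence when [a_1 = 1]. *)
Fixpoint jsol (c d y : R) (k : nat) : R :=
  match k with
  | 0 => c
  | k1.+1 =>
    match k1 with
    | 0 => d + c * y
    | k2.+1 => (a k1.+1)^-1 * (y * jsol c d y k1 + a k1 * jsol c d y k2)
    end
  end.

Lemma jsolS c d y k : a k.+2 * jsol c d y k.+2 =
  y * jsol c d y k.+1 + a k.+1 * jsol c d y k.
Proof. by rewrite [in LHS]/= mulrA divff ?mul1r// lt0r_neq0. Qed.

Lemma jsol_ind2 (P : nat -> Prop) : P 0 -> P 1 ->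
  (forall k, P k -> P k.+1 -> P k.+2) -> forall k, P k.
Proof.
move=> P0 P1 PS k; suff : P k /\ P k.+1 by case.
by elim: k => // k [Pk Pk1]; split=> //; exact: PS.
Qed.

Lemma jsol0 c d y : jsol c d y 0 = c. Proof. by []. Qed.
Lemma jsol1 c d y : jsol c d y 1 = d + c * y. Proof. by []. Qed.
Arguments jsol : simpl never.

Lemma jsol_ge0 c d y k : 0 <= c -> 0 <= d -> 0 <= y -> 0 <= jsol c d y k.
Proof.
move=> c0 d0 y0; elim/jsol_ind2 : k => //; first by rewrite addr_ge0// mulr_ge0.
move=> k fk fk1; rewrite -(pmulr_rge0 _ (a_gt0 k.+1)) jsolS.
by rewrite addr_ge0// mulr_ge0// (ltW (a_gt0 _)).
Qed.

Lemma jsolD c d c' d' y k :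
  jsol (c + c') (d + d') y k = jsol c d y k + jsol c' d' y k.
Proof.
elim/jsol_ind2 : k => [||k h0 h1] //; first by rewrite !jsol1; ring.
apply: (mulfI (lt0r_neq0 (a_gt0 k.+1))).
by rewrite mulrDr !jsolS h0 h1; ring.
Qed.

(** The Casoratian of a solution [e] at spectral parameter [0] and a solution
    [f] at spectral parameter [y]; the sign is [+] since the recurrence has been
    rotated to the imaginary axis. *)
Definition wr (e f : nat -> R) n := a n.+1 * (e n * f n.+1 + e n.+1 * f n).

(** Christoffel-Darboux: consecutive Casoratians differ by [y e_n f_n]. Up to a
    unimodular factor, the right-hand side is a partial sum of a Nevanlinna
    function at [i y]. *)
Lemma wr_sum c d c' d' y n :
  wr (jsol c d 0) (jsol c' d' y) n =
  (c * d' + d * c') + y * \sum_(k < n.+1) (jsol c d 0 k * jsol c' d' y k).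
Proof.
elim: n => [|n IH].
  by rewrite big_ord_recr big_ord0 /wr /= a1 !jsol1 !jsol0; ring.
rewrite big_ord_recr /= mulrDr addrA -IH /wr.
have := jsolS c d 0 n; have := jsolS c' d' y n.
set e := jsol c d 0; set f := jsol c' d' y => h1 h2.
have -> : a n.+2 * (e n.+1 * f n.+2 + e n.+2 * f n.+1)
  = e n.+1 * (a n.+2 * f n.+2) + (a n.+2 * e n.+2) * f n.+1 by ring.
by rewrite h1 h2; ring.
Qed.

Definition lamj (y : R) j := lam (y / a j).
Definition Lam (y : R) n := \prod_(j < n) lamj y j.+1.

Lemma lamj_gt0 y j : 0 < lamj y j. Proof. exact: lam_gt0. Qed.
Lemma Lam_gt0 y n : 0 < Lam y n.
Proof. by apply: prodr_gt0 => i _; exact: lamj_gt0. Qed.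
Lemma LamS y n : Lam y n.+1 = Lam y n * lamj y n.+1.
Proof. by rewrite /Lam big_ord_recr. Qed.

Lemma lamj_mono y j : 0 <= y -> a j.+1 * lamj y j.+1 <= a j.+2 * lamj y j.+2.
Proof. by move=> y0; apply: lam_mulr_mono. Qed.

(** This is [y + a_k / lam_k = a_k lam_k] for [lam_k := lam (y / a_k)]: the
    product [Lam] solves the recurrence up to the slow variation of
    [a_k lam_k]. *)
Lemma Lam_rec y k : y * Lam y k.+1 + a k.+1 * Lam y k =
  Lam y k.+1 * (a k.+1 * lamj y k.+1).
Proof.
rewrite LamS; have := lam_sqr (y / a k.+1); rewrite -/(lamj _ _) => h.
have -> : Lam y k * lamj y k.+1 * (a k.+1 * lamj y k.+1)
  = Lam y k * a k.+1 * (lamj y k.+1 ^+ 2) by ring.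
rewrite h; field; exact: lt0r_neq0.
Qed.

(** Upper WKB bound: [Lam] is a supersolution because [a_k lam_k] increases
    with [k]. *)
Lemma jsol_le c d y k : 0 <= c -> 0 <= d -> 0 <= y ->
  c <= 1 -> d + c * y <= lamj y 1 -> jsol c d y k <= Lam y k.
Proof.
move=> c0 d0 y0 c1 f1; elim/jsol_ind2 : k => [||k h0 h1].
- by rewrite /Lam big_ord0.
- by rewrite /Lam big_ord1.
rewrite -(ler_pM2l (a_gt0 k.+1)) jsolS LamS.
apply: (@le_trans _ _ (y * Lam y k.+1 + a k.+1 * Lam y k)).
  by rewrite lerD// ler_wpM2l// ltW.
rewrite Lam_rec [leRHS]mulrCA ler_wpM2l ?(ltW (Lam_gt0 _ _))//.
exact: lamj_mono.
Qed.

(** Lower WKB bound: [Lam_(k-1) / a_k = Lam_k / (a_k lam_k)] is a subsolution,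
    for the same reason that makes [Lam] a supersolution. Compared with the
    upper bound only a factor polynomial in [k] and [y] is lost. *)
Lemma jsol_ge c d y k : 0 <= c -> 0 <= d -> 0 <= y ->
  1 <= 2 * (d + c * y) -> lamj y 1 <= 2 * (y * (d + c * y) + c) ->
  Lam y k <= 2 * (a k.+1 * jsol c d y k.+1).
Proof.
move=> c0 d0 y0 f1 f2; elim/jsol_ind2 : k => [||k h0 h1].
- by rewrite /Lam big_ord0 a1 mul1r jsol1.
- by rewrite /Lam big_ord1 jsolS a1 mul1r jsol1 jsol0.
rewrite jsolS !LamS; have := lam_sqr (y / a k.+2); rewrite -/(lamj _ _).
move: h0 h1; rewrite LamS.
have v0 : 0 <= jsol c d y k.+1 by exact: jsol_ge0.
have lk := lamj_mono k y0.
have l1 := lamj_gt0 y k.+1; have l2 := lamj_gt0 y k.+2.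
have B0 := a_gt0 k.+1; have L0 := Lam_gt0 y k.
move: (jsol c d y k.+2) (jsol c d y k.+1) (lamj y k.+1) (lamj y k.+2)
  (a k.+1) (a k.+2) (Lam y k) v0 lk l1 l2 B0 L0 => u v s t A B L.
move=> v0 lk s0 t0 B0 L0 h0 h1 ht.
have {}ht : B * t ^+ 2 = y * t + B by rewrite ht; field; exact: lt0r_neq0.
rewrite -(ler_pM2l (mulr_gt0 B0 t0)).
have -> : B * t * (L * s * t) = L * s * (B * t ^+ 2) by ring.
rewrite ht.
have h2 : L * s * (y * t) <= 2 * (B * u) * (y * t).
  by rewrite ler_wpM2r// mulr_ge0// ltW.
have h3 : L * (s * B) <= 2 * (A * v) * (s * B).
  by rewrite ler_wpM2r// mulr_ge0// ltW.
have h4 : A * s * (2 * v * B) <= B * t * (2 * v * B).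
  by rewrite ler_wpM2r// !mulr_ge0// ltW.
lra.
Qed.

(** The sum of the solutions of the first and second kind at spectral
    parameter [0]. Each of the two vanishes at every other index; their sum is
    positive everywhere. *)
Definition sol0 := jsol 1 1 0.

Lemma sol0_rec k : a k.+2 * sol0 k.+2 = a k.+1 * sol0 k.
Proof. by rewrite /sol0 jsolS mul0r add0r. Qed.

Lemma sol0_ge0 k : 0 <= sol0 k. Proof. exact: jsol_ge0. Qed.

(** At spectral parameter [0] the recurrence says that the products
    [a_(n+1) x_n x_(n+1)] do not depend on [n]. *)
Lemma sol0_prod n : a n.+1 * (sol0 n * sol0 n.+1) = 1.
Proof.
elim: n => [|n IH]; first by rewrite /sol0 jsol0 jsol1 a1; ring.
by rewrite mulrCA sol0_rec mulrCA (mulrC (sol0 n.+1)) IH.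
Qed.

Lemma sol0_le1 k : sol0 k <= 1.
Proof.
elim/jsol_ind2 : k => [||k h0 _]; rewrite /sol0 ?jsol0 ?jsol1 ?mulr0 ?addr0//.
rewrite -/sol0 -(ler_pM2l (a_gt0 k.+1)) sol0_rec.
by rewrite ler_pM ?sol0_ge0 ?(ltW (a_gt0 _)).
Qed.

Local Notation bsol b := (jsol (b : bool)%:R (~~ b)%:R).

Lemma bsol_le_sol0 (b : bool) k : bsol b 0 k <= sol0 k.
Proof.
have -> : sol0 k = jsol (b%:R + (~~ b)%:R) ((~~ b)%:R + b%:R) 0 k.
  by rewrite /sol0; case: b; rewrite ?addr0 ?add0r.
by rewrite jsolD lerDl jsol_ge0// ler0n.
Qed.

Lemma bsol_ge0 (b : bool) y k : 0 <= y -> 0 <= bsol b y k.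
Proof. by move=> y0; rewrite jsol_ge0// ler0n. Qed.

Lemma lam_gex (x : R) : x <= lam x.
Proof. by rewrite -subr_ge0 -lamV invr_ge0 ltW// lam_gt0. Qed.

Lemma bsol_le_Lam (b : bool) y k : 0 <= y ->
  bsol b y k <= Lam y k.
Proof.
move=> y0; apply: jsol_le => //; rewrite ?ler0n ?lern1 ?leq_b1//.
rewrite /lamj a1 divr1; case: b; rewrite ?mul1r ?add0r ?mul0r ?addr0.
  exact: lam_gex.
exact: lam_ge1.
Qed.

Lemma bsol_ge_Lam (b : bool) y k : 1 <= y ->
  Lam y k <= 2 * (a k.+1 * bsol b y k.+1).
Proof.
move=> y1; have y0 : 0 <= y by lra.
have := lam_le y0.
move=> h; apply: jsol_ge => //; rewrite ?ler0n// /lamj ?a1 ?divr1.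
  by case: b => /=; nra.
by case: b => /=; nra.
Qed.

Lemma Lam_mono y m n : 0 <= y -> (m <= n)%N -> Lam y m <= Lam y n.
Proof.
move=> y0 /subnK <-; elim: (n - m)%N => // k IH; rewrite addSn LamS.
rewrite (le_trans IH)// ler_peMr ?(ltW (Lam_gt0 _ _))//.
by apply: lam_ge1; rewrite divr_ge0// ltW.
Qed.

Lemma wr_mono (b b' : bool) y : 0 <= y ->
  {homo wr (bsol b 0) (bsol b' y) : m n / (m <= n)%N >-> m <= n}.
Proof.
move=> y0; apply: homo_leq; first by []; first exact: le_trans.
move=> n; rewrite !wr_sum lerD2l ler_wpM2l// [leRHS]big_ord_recr /= lerDl.
by rewrite mulr_ge0// bsol_ge0.
Qed.

(** At every second index [n] the solution [e] at [0] satisfies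
    [a_(n+1) e_n >= 1], so that there the Casoratian dominates [f_(n+1)]. *)
Lemma wr_lower (b b' : bool) y n : 1 <= y ->
  exists m, Lam y n <= 2 * a n.+2 *
    wr (bsol b 0) (bsol b' y) m.
Proof.
move=> y1; have y0 : 0 <= y by lra.
set e := bsol b 0; set f := bsol b' y.
have e0 k : 0 <= e k by apply: bsol_ge0.
have f0 k : 0 <= f k by apply: bsol_ge0.
have a_ge0 k : 0 <= a k.+1 by apply: ltW.
have te k : a k.+1 * e k <= a k.+3 * e k.+2.
  rewrite -[leLHS]add0r -[X in X + _](mul0r (e k.+1)) /e -jsolS -/e.
  by rewrite ler_wpM2r.
have H : 1 <= a n.+1 * e n \/ 1 <= a n.+2 * e n.+1.
  elim: n => [|n [h|h]].
  - rewrite /e jsol0 jsol1 mulr0 addr0 a1; case: b {e e0 te}.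
      by left; rewrite mulr1.
    by right; rewrite mulr1 (le_trans _ (a_mono 0))// a1.
  - by right; rewrite (le_trans h).
  - by left.
have W m : 1 <= a m.+1 * e m -> Lam y m <= 2 * a m.+1 * wr e f m.
  move=> h; rewrite (le_trans (bsol_ge_Lam b' _ y1))// -/f mulrA.
  rewrite ler_wpM2l ?mulr_ge0// /wr mulrDr mulrA.
  rewrite (@le_trans _ _ (a m.+1 * e m * f m.+1))//.
    by rewrite ler_peMl.
  by rewrite lerDl !mulr_ge0.
have w0 m : 0 <= wr e f m by rewrite /wr mulr_ge0// addr_ge0// mulr_ge0.
case: H => /W h; [exists n|exists n.+1].
  rewrite (le_trans h)// ler_wpM2r// ler_wpM2l//.
by rewrite (le_trans _ h)// Lam_mono.
Qed.

(** The Casoratian [U_n] of [sol0] with [f] satisfies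
    [f_(n+1) <= sol0_(n+1) U_n] by [sol0_prod], hence
    [U_(n+1) <= (1 + y sol0_(n+1)^2) U_n]. Starting this from an index [K], where
    the WKB bound is used, gives an estimate that is uniform in [n]. *)
Lemma wr_upper (b b' : bool) y K n : 0 <= y ->
  wr (bsol b 0) (bsol b' y) n <=
  2 * a K.+1 * Lam y K.+1 * expR (y * \sum_(K <= j < K + n) sol0 j.+1 ^+ 2).
Proof.
move=> y0.
set e := bsol b 0; set f := bsol b' y.
have e0 k : 0 <= e k by apply: bsol_ge0.
have f0 k : 0 <= f k by apply: bsol_ge0.
have a_ge0 k : 0 <= a k.+1 by apply: ltW.
apply: (@le_trans _ _ (wr e f (K + n))).
  by apply: wr_mono => //; rewrite leq_addl.
apply: (@le_trans _ _ (wr sol0 f (K + n))).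
  by rewrite /wr ler_wpM2l// lerD// ler_wpM2r// bsol_le_sol0.
elim: n => [|n IH].
  rewrite addn0 big_geq// mulr0 expR0 mulr1 /wr mulrAC [leRHS]mulrC ler_wpM2l//.
  have hf k : (k <= K.+1)%N -> f k <= Lam y K.+1.
    by move=> kK; rewrite (le_trans (bsol_le_Lam _ _ _))// Lam_mono.
  have hx k j : (k <= K.+1)%N -> sol0 j * f k <= Lam y K.+1.
    move=> kK; rewrite -[leRHS]mul1r ler_pM ?sol0_ge0 ?sol0_le1//; exact: hf.
  by rewrite mulrDl mul1r lerD// hx.
rewrite addnS big_nat_recr ?leq_addr//= mulrDr expRD mulrA.
set E := _ * expR (y * \sum_(_ <= _ < _) _) in IH *.
have wS k : wr sol0 f k.+1 = wr sol0 f k + y * (sol0 k.+1 * f k.+1).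
  by rewrite /sol0 /f !wr_sum [in LHS]big_ord_recr /=; ring.
rewrite wS; set k := (K + n)%N in IH *.
have hf : f k.+1 <= sol0 k.+1 * wr sol0 f k.
  have -> : sol0 k.+1 * wr sol0 f k = a k.+1 * (sol0 k * sol0 k.+1) * f k.+1 +
    a k.+1 * sol0 k.+1 * sol0 k.+1 * f k by rewrite /wr; ring.
  by rewrite sol0_prod mul1r lerDl !mulr_ge0// sol0_ge0.
apply: (@le_trans _ _ (wr sol0 f k * (1 + y * sol0 k.+1 ^+ 2))).
  rewrite mulrDr mulr1 lerD2l [leRHS]mulrCA ler_wpM2l// expr2 [leRHS]mulrCA.
  by rewrite ler_wpM2l ?sol0_ge0// [leRHS]mulrC.
have x20 : 0 <= y * sol0 k.+1 ^+ 2 by rewrite mulr_ge0// sqr_ge0.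
rewrite ler_pM//; [|by lra|exact: expR_ge1Dx].
by rewrite /wr mulr_ge0// addr_ge0// mulr_ge0// sol0_ge0.
Qed.

End real_rec.

(** * The weights [j^p] *)

Section powers.
Context {R : realType}.
Implicit Types p : R.

(** Comparison of the sum of [n^-p] with the integral of [x^-p], in telescoping
    form. *)
Lemma powR_tail_step p n : 1 < p ->
  (p - 1) * n.+2%:R `^ (- p) <= n.+1%:R `^ (1 - p) - n.+2%:R `^ (1 - p).
Proof.
move=> p1; set u : R := n.+1%:R; set v : R := n.+2%:R.
have u0 : 0 < u by rewrite ltr0n.
have v0 : 0 < v by rewrite ltr0n.
have uv : u = v - 1 by rewrite /u /v -[n.+2]addn1 natrD addrK.
have -> : v `^ (- p) = v `^ (1 - p) / v.
  rewrite -[X in _ / X]powRr1 ?(ltW v0)// -powRB; last by apply/implyP=> _; rewrite gt_eqF.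
  by congr (_ `^ _); ring.
have -> : u `^ (1 - p) = v `^ (1 - p) * expR ((1 - p) * ln (u / v)).
  have -> : expR ((1 - p) * ln (u / v)) = (u / v) `^ (1 - p).
    by rewrite /powR gt_eqF// divr_gt0.
  rewrite -powRM ?divr_ge0 ?(ltW u0) ?(ltW v0)//; congr (_ `^ _).
  by field; rewrite gt_eqF.
set E := expR _; set A := v `^ _.
have h : ln (u / v) <= - v^-1.
  have -> : u / v = 1 + - v^-1 by rewrite uv; field; rewrite gt_eqF.
  apply: le_ln1Dx; rewrite ltrN2 invf_lt1// /v ltr1n//.
have h2 : 1 + (p - 1) / v <= E.
  rewrite /E (le_trans _ (expR_ge1Dx _))// lerD2l.
  have p0 : 0 <= p - 1 by lra.
  by rewrite -[1 - p]opprB mulNr lerNr -mulrN ler_wpM2l.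
have := ler_wpM2l (powR_ge0 v (1 - p)) h2; rewrite -/A.
by rewrite mulrDr mulr1 [A * (_ / v)]mulrCA lerBrDl.
Qed.

Lemma powR_tail p m n : 1 < p -> (0 < m)%N ->
  \sum_(m <= j < m + n) j.+1%:R `^ (- p) <= m%:R `^ (1 - p) / (p - 1).
Proof.
move=> p1 m0; have p0 : 0 < p - 1 by lra.
rewrite ler_pdivlMr//.
suff : (\sum_(m <= j < m + n) j.+1%:R `^ (- p)) * (p - 1) <=
    m%:R `^ (1 - p) - (m + n)%:R `^ (1 - p).
  by have := powR_ge0 ((m + n)%:R : R) (1 - p); lra.
elim: n => [|n IH]; first by rewrite addn0 big_geq// mul0r subrr.
rewrite addnS big_nat_recr ?leq_addr//= mulrDl.
have := powR_tail_step (m + n).-1 p1; rewrite prednK ?addn_gt0 ?m0//.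
by move: IH; rewrite !(mulrC _ (p - 1)); lra.
Qed.

Definition pw p (j : nat) : R := j%:R `^ p.

Lemma pw_gt0 p k : 0 < pw p k.+1. Proof. by rewrite powR_gt0// ltr0n. Qed.
Lemma pw1 p : pw p 1 = 1. Proof. by rewrite /pw powR1. Qed.
Lemma pw_mono p m n : 0 <= p -> (m <= n)%N -> pw p m <= pw p n.
Proof. by move=> p0 mn; rewrite ge0_ler_powR ?nnegrE ?ler0n// ler_nat. Qed.

Lemma pw_logconcave p n : 0 <= p -> pw p n * pw p n.+2 <= pw p n.+1 ^+ 2.
Proof.
move=> p0; rewrite /pw expr2 -!powRM ?ler0n// ge0_ler_powR ?nnegrE ?mulr_ge0 ?ler0n//.
by rewrite -!natrM ler_nat; lia.
Qed.

(** [sol0_k^2 = O(k^-p)]: the recurrence over two steps multiplies [sol0] by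
    [((k+1)/(k+2))^p], and [pw_logconcave] compares the square of this factor
    with [((k+1)/(k+3))^p]. *)
Lemma sol0_sqr p k : 1 < p -> sol0 (pw p) k ^+ 2 * pw p k.+1 <= 2 `^ p.
Proof.
move=> p1; have p0 : 0 <= p by lra.
have T : 1 <= 2 `^ p :> R.
  by have := pw_mono p0 (isT : (1 <= 2)%N); rewrite pw1.
elim/jsol_ind2 : k => [||k h _].
- by rewrite /sol0 jsol0 pw1 expr1n mulr1.
- by rewrite /sol0 jsol1 mulr0 addr0 expr1n mul1r.
apply: le_trans h.
have := sol0_rec (pw_gt0 p) k; have := pw_logconcave k.+1 p0.
have := pw_gt0 p k; have := pw_gt0 p k.+1; have := pw_gt0 p k.+2.
move: (sol0 _ k.+2) (sol0 _ k) (pw p k.+1) (pw p k.+2) (pw p k.+3) => u v A B C.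
move=> C0 B0 A0 h e.
rewrite -(ler_pM2l (exprn_gt0 2 B0)) mulrA -exprMn e exprMn.
have -> : A ^+ 2 * v ^+ 2 * C = A * v ^+ 2 * (A * C) by ring.
have -> : B ^+ 2 * (v ^+ 2 * A) = A * v ^+ 2 * B ^+ 2 by ring.
by rewrite ler_wpM2l// mulr_ge0 ?sqr_ge0// ltW.
Qed.

Lemma sol0_tail p K n : 1 < p -> (0 < K)%N ->
  \sum_(K <= j < K + n) sol0 (pw p) j.+1 ^+ 2 <= 2 `^ p / (p - 1) * K%:R `^ (1 - p).
Proof.
move=> p1 K0; rewrite -mulrA [_^-1 * _]mulrC.
rewrite (le_trans _ (ler_wpM2l (powR_ge0 _ _) (powR_tail n p1 K0)))//.
rewrite mulr_sumr ler_sum// => j _.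
have h := sol0_sqr j.+1 p1; have j0 := pw_gt0 p j.+1.
rewrite powRN -/(pw p j.+1) (@le_trans _ _ (2 `^ p / pw p j.+2))//.
  by rewrite ler_pdivlMr.
rewrite ler_wpM2l ?powR_ge0// lef_pV2 ?posrE ?pw_gt0//.
apply: pw_mono => //; lra.
Qed.

(** In [wr_upper] the exponent is of order [y K^(1-p)], which stays bounded
    when [K] is about [y^(1/(p-1))]; the factor [a_(K+1)] is then a power of
    [y]. *)
Lemma wr_upper_pw p : 1 < p -> exists C D : R, [/\ 0 < C, 0 <= D &
  forall (b b' : bool) y n, 1 <= y -> exists K,
  wr (pw p) (jsol (pw p) b%:R (~~ b)%:R 0) (jsol (pw p) b'%:R (~~ b')%:R y) n <=
  C * y `^ D * Lam (pw p) y K].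
Proof.
move=> p1; have p0 : 0 <= p by lra.
have pp : 0 < p - 1 by lra.
exists (2 * 3 `^ p * expR (2 `^ p / (p - 1))), ((p - 1)^-1 * p); split.
- by rewrite !mulr_gt0 ?expR_gt0 ?powR_gt0.
- by rewrite mulr_ge0// invr_ge0 ltW.
move=> b b' y n y1; have y0 : 0 < y by lra.
set q := y `^ (p - 1)^-1.
have q1 : 1 <= q.
  by rewrite -(powRr0 y) ler_powR// invr_ge0 ltW.
have q0 : 0 < q by lra.
have /andP[tq qt] := truncn_itv (ltW q0).
pose K := (Num.truncn q).+1.
exists K.+1.
have a_mono k : pw p k.+1 <= pw p k.+2 by apply: pw_mono.
have y0' := ltW y0.
rewrite (le_trans (wr_upper (pw_gt0 p) (pw1 p) a_mono b b' K n y0'))//.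
have L0 := Lam_gt0 (pw p) y K.+1.
have A : pw p K.+1 <= 3 `^ p * y `^ ((p - 1)^-1 * p).
  rewrite powRrM -/q -powRM ?(ltW q0)//.
  rewrite ge0_ler_powR ?nnegrE ?ler0n// ?mulr_ge0 ?(ltW q0)//.
  by rewrite -[K.+1]addn1 /K -[(_).+1]addn1 !natrD; lra.
have B : y * (\sum_(K <= j < K + n) sol0 (pw p) j.+1 ^+ 2) <= 2 `^ p / (p - 1).
  apply: le_trans (ler_wpM2l y0' (sol0_tail n p1 (ltn0Sn _))) _.
  rewrite mulrCA ler_piMr ?divr_ge0 ?powR_ge0 ?(ltW pp)//.
  rewrite -[1 - p]opprB powRN ler_pdivrMr ?powR_gt0 ?ltr0n// mul1r.
  have -> : y = q `^ (p - 1).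
    by rewrite -powRrM mulVf ?powRr1// gt_eqF.
  by rewrite ge0_ler_powR ?nnegrE ?ler0n ?(ltW q0) ?(ltW pp)// ltW.
have -> : 2 * 3 `^ p * expR (2 `^ p / (p - 1)) * y `^ ((p - 1)^-1 * p) *
   Lam (pw p) y K.+1 = 2 * (3 `^ p * y `^ ((p - 1)^-1 * p)) *
   Lam (pw p) y K.+1 * expR (2 `^ p / (p - 1)) by ring.
rewrite ler_pM ?expR_ge0 ?ler_expR// ?mulr_ge0 ?powR_ge0 ?(ltW L0)//.
by rewrite ler_wpM2r ?(ltW L0)// ler_wpM2l.
Qed.

End powers.

(** * The beta integral as a limit of sums of logarithms *)

Section count.
Context {R : realType}.

(** The number of positive integers [<= x] among the first [N] ones is at most
    [x], and is at least [x - 1] unless it is [N]. *)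
Lemma count_le (x : R) N : 0 <= x -> \sum_(j < N) ((j.+1%:R <= x)%R%:R : R) <= x.
Proof.
move=> x0'; elim: N => [|N IH]; first by rewrite big_ord0.
have [NX|XN] := leP (N.+1%:R) x.
  apply: le_trans NX; rewrite -[X in _ <= X%:R](card_ord N.+1) -sum1_card natr_sum.
  by apply: ler_sum => j _; rewrite lern1 leq_b1.
by rewrite big_ord_recr /= (lt_geF XN) addr0.
Qed.

Lemma count_ge (x : R) N :
  Num.min N%:R (x - 1) <= \sum_(j < N) ((j.+1%:R <= x)%R%:R : R).
Proof.
elim: N => [|N IH]; first by rewrite big_ord0 ge_min lexx.
have [NX|XN] := leP (N.+1%:R) x.
  rewrite ge_min; apply/orP; left.
  rewrite -[X in X%:R <= _](card_ord N.+1) -sum1_card natr_sum.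
  apply: ler_sum => j _; rewrite (le_trans _ NX)// ler_nat; exact: ltn_ord.
rewrite big_ord_recr /= (lt_geF XN) addr0 (le_trans _ IH)// le_min.
by rewrite !ge_min lexx orbT andbT; apply/orP; right; move: XN; rewrite -addn1 natrD; lra.
Qed.

End count.

Section beta.
Context {R : realType}.
Variable p : R.
Hypothesis p1 : 1 < p.
Local Notation mu := (@lebesgue_measure R).

(** The integrand of the beta integral in the claimed type. *)
Definition bint (t : R) : R := t `^ ((2 * p)^-1 - 1) * (1 - t) `^ (1 - p^-1 - 1).

Lemma bint_ge0 t : 0 <= bint t.
Proof. by rewrite mulr_ge0// powR_ge0. Qed.

Lemma measurable_bint D : measurable D -> measurable_fun D bint.
Proof.
move=> mD; apply: (@measurable_funS _ _ _ _ setT) => //.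
apply: measurable_funM; first exact: measurable_powR.
apply: (measurableT_comp (@measurable_powR R _)).
exact: measurable_funB.
Qed.

(** With [lam_j = exp u_j], this is the value of [t = exp (- 2 u)] at [u_j]. *)
Definition tau (y : R) j : R := (lamj (pw p) y j ^+ 2)^-1.

(** The substitution [t = exp (- 2 u)] that produces the beta integral:
    [exp (- 2 u_j) <= t] means that [j^p] is at most [y / (2 sinh u)], which is
    [y sqrt t / (1 - t)]. *)
Lemma tau_le y j t : 0 < y -> 0 < t < 1 ->
  (tau y j.+1 <= t) = (j.+1%:R <= y `^ p^-1 * (t * bint t)).
Proof.
move=> y0 /andP[t0 t1].
set r := t `^ 2^-1.
have r0 : 0 < r by rewrite powR_gt0.
have rt : r ^+ 2 = t.
  by rewrite -powR_mulrn ?(ltW r0)// -powRrM mulVf// powRr1// ltW.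
have l0 : 0 < lamj (pw p) y j.+1 := lamj_gt0 _ _ _.
have a0 := pw_gt0 p j.
have u0 : 0 < 1 - t by lra.
transitivity (r^-1 - r <= y / pw p j.+1).
  have -> : (r^-1 - r <= y / pw p j.+1) = (r^-1 <= lamj (pw p) y j.+1).
    by rewrite le_lam ?invr_gt0// invrK.
  rewrite /tau -rt -exprVn.
  by rewrite ler_pXn2r ?nnegrE ?invr_ge0 ?(ltW l0) ?(ltW r0)// invf_ple ?posrE.
transitivity (pw p j.+1 <= y * r / (1 - t)).
  rewrite ler_pdivlMr// ler_pdivlMr//.
  have -> : r^-1 - r = (1 - t) / r by rewrite -rt; field; rewrite gt_eqF.
  by rewrite mulrAC ler_pdivrMr// mulrC.
have p0 : 0 < p by apply: lt_trans p1.
have q0 : 0 <= p^-1 by rewrite invr_ge0 ltW.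
have Y0 : 0 <= y * r / (1 - t) by rewrite divr_ge0 ?mulr_ge0// ltW.
have -> : y `^ p^-1 * (t * bint t) = (y * r / (1 - t)) `^ p^-1.
  rewrite !powRM ?invr_ge0 ?mulr_ge0 ?(ltW y0) ?(ltW r0) ?(ltW u0)//.
  rewrite -mulrA; congr (_ * _); rewrite /bint mulrA; congr (_ * _); last first.
    by rewrite -(powR_inv1 (ltW u0)) -powRrM; congr (_ `^ _); ring.
  rewrite -[X in X * _ `^ _](powRr1 (ltW t0)) -powRD; last first.
      by apply/implyP => _; rewrite gt_eqF.
  by rewrite /r -powRrM; congr (_ `^ _); field; rewrite gt_eqF.
have -> : (j.+1%:R : R) = pw p j.+1 `^ p^-1.
  by rewrite /pw -powRrM mulfV ?powRr1// gt_eqF.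
apply/idP/idP => [h|].
  by rewrite ge0_ler_powR ?nnegrE ?(ltW a0).
apply: contraTT; rewrite -!ltNge => h.
by rewrite gt0_ltr_powR ?nnegrE ?(ltW a0) ?invr_gt0.
Qed.

(** Its integral over [0 < t < 1] is [- ln c]. *)
Definition phi (c t : R) : R := (c <= t)%R%:R / t.

Lemma phiE c : phi c = (fun t => \1_`[c, +oo[%classic t * t^-1).
Proof.
apply/funext => t; rewrite /phi indicE; congr (_%:R / _).
by rewrite mem_setE in_itv/= andbT.
Qed.

Lemma measurable_inv01 (c : R) : 0 <= c ->
  measurable_fun (`]c, 1[%classic : set R) (@GRing.inv R).
Proof.
move=> c0; apply: open_continuous_measurable_fun; first exact: interval_open.
move=> x /[!inE] /=; rewrite in_itv/= => /andP[x0 _]; apply: inv_continuous.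
by rewrite gt_eqF// (le_lt_trans c0).
Qed.

Lemma measurable_phi c : measurable_fun (`]0, 1[%classic : set R) (phi c).
Proof.
rewrite phiE; apply: measurable_funM; first exact: measurable_indic.
exact: measurable_inv01.
Qed.

Lemma phi_ge0 c t : 0 < t -> 0 <= phi c t.
Proof. by move=> t0; rewrite divr_ge0// ltW. Qed.

Lemma integral_phi c : 0 < c < 1 ->
  (\int[mu]_(t in `]0%R, 1%R[) (phi c t)%:E = (- ln c)%:E)%E.
Proof.
move=> /andP[c0 c1].
have -> : (\int[mu]_(t in `]0%R, 1%R[) (phi c t)%:E =
   \int[mu]_(t in `[c, 1%R[) (t^-1)%:E)%E.
  have -> : `[c, 1[%classic = `]0, 1[ `&` `[c, +oo[ :> set R.
    apply/seteqP; split => x /=; rewrite !in_itv/= ?andbT.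
      by move=> /andP[cx ->]; rewrite cx (lt_le_trans c0).
    by move=> [/andP[_ ->] ->].
  rewrite integral_mkcondr; apply: eq_integral => t _.
  by rewrite phiE epatch_indic /= mulrC -EFinM.
rewrite integral_itv_bndo_bndc; last first.
  apply/measurable_EFinP.
  apply: measurable_funS (measurable_inv01 (lexx 0)) => //.
  by move=> x /=; rewrite !in_itv/= => /andP[cx ->]; rewrite (lt_le_trans c0).
have ge0c x : c <= x -> 0 < x by apply: lt_le_trans.
rewrite (@continuous_FTC2 _ (@GRing.inv R) (@ln R))//.
- by rewrite ln1 sub0e.
- apply: continuous_in_subspaceT => x /[!inE]/=; rewrite in_itv/= => /andP[cx _].
  by apply: inv_continuous; rewrite gt_eqF// ge0c.
- split.
  + move=> x; rewrite in_itv/= => /andP[/ltW/ge0c x0 _].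
    exact: (@ex_derive _ _ _ _ _ _ _ (is_derive1_ln x0)).
  + by apply: cvg_at_right_filter; exact: continuous_ln.
  + by apply: cvg_at_left_filter; exact: continuous_ln.
- move=> x; rewrite in_itv/= => /andP[/ltW/ge0c x0 _].
  by rewrite derive1E (@derive_val _ _ _ _ _ _ _ (is_derive1_ln x0)).
Qed.

Lemma p_gt0 : 0 < p. Proof. exact: lt_trans p1. Qed.

Lemma ln_Lam y N : ln (Lam (pw p) y N) = \sum_(j < N) ln (lamj (pw p) y j.+1).
Proof.
elim: N => [|N IH]; first by rewrite /Lam !big_ord0 ln1.
by rewrite LamS lnM ?posrE ?Lam_gt0 ?lamj_gt0// IH big_ord_recr.
Qed.

Lemma tau01 y j : 0 < y -> 0 < tau y j.+1 < 1.
Proof.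
move=> y0; have l0 : 0 < lamj (pw p) y j.+1 := lamj_gt0 _ _ _.
rewrite /tau invr_gt0 exprn_gt0//= invf_lt1 ?exprn_gt0// exprn_egt1//.
rewrite ltNge; apply/negP => l1.
have : lamj (pw p) y j.+1 <= 1 <= (lamj (pw p) y j.+1)^-1 by rewrite l1 invf_ge1.
have z0 : 0 < y / pw p j.+1 by rewrite divr_gt0// pw_gt0.
by rewrite /lamj lamV => /andP[? ?]; lra.
Qed.

Lemma ln_tau y j : - ln (tau y j.+1) = 2 * ln (lamj (pw p) y j.+1).
Proof.
have l0 : 0 < lamj (pw p) y j.+1 := lamj_gt0 _ _ _.
rewrite /tau lnV ?posrE ?exprn_gt0// opprK expr2 lnM ?posrE//; ring.
Qed.

(** Layer-cake formula: [ln (Lam y N)] is the sum of the logarithms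
    [ln (lam (y / j^p))], each of which is half the integral of [phi (tau j)]. *)
Lemma integral_phi_sum y N : 0 < y ->
  (\int[mu]_(t in `]0%R, 1%R[) (\sum_(j < N) phi (tau y j.+1) t)%:E =
  (2 * ln (Lam (pw p) y N))%:E)%E.
Proof.
move=> y0; under eq_integral do rewrite -sumEFin.
rewrite ge0_integral_sum//.
- rewrite ln_Lam mulr_sumr -sumEFin; apply: eq_bigr => j _.
  by rewrite integral_phi ?tau01// ln_tau.
- by move=> j; apply/measurable_EFinP; exact: measurable_phi.
- move=> j t /=; rewrite in_itv/= => /andP[t0 _].
  by rewrite lee_fin phi_ge0.
Qed.

(** By [tau_le], summing the indicator functions counts integers, so the
    integrand of the layer-cake formula is comparable with [bint]. *)
Lemma phi_sumE y N t : 0 < y -> 0 < t < 1 -> \sum_(j < N) phi (tau y j.+1) t =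
  (\sum_(j < N) ((j.+1%:R <= y `^ p^-1 * (t * bint t))%R%:R : R)) / t.
Proof.
move=> y0 t01; rewrite mulr_suml; apply: eq_bigr => j _.
by rewrite /phi tau_le.
Qed.

Lemma phi_sum_le y N t : 0 < y -> 0 < t < 1 ->
  \sum_(j < N) phi (tau y j.+1) t <= y `^ p^-1 * bint t.
Proof.
move=> y0 t01; rewrite phi_sumE//; have /andP[t0 _] := t01.
rewrite ler_pdivrMr// mulrAC -mulrA count_le// mulr_ge0 ?powR_ge0//.
by rewrite mulr_ge0 ?bint_ge0// ltW.
Qed.

Lemma ln_Lam_leE y N : 0 < y -> ((2 * ln (Lam (pw p) y N))%:E <=
  (y `^ p^-1)%:E * \int[mu]_(t in `]0%R, 1%R[) (bint t)%:E)%E.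
Proof.
move=> y0; rewrite -integral_phi_sum//.
have mb : measurable_fun (`]0, 1[%classic : set R) (EFin \o bint).
  by apply/measurable_EFinP; exact: measurable_bint.
rewrite -ge0_integralZl//; last 2 first.
- by move=> t _; rewrite lee_fin bint_ge0.
- by rewrite lee_fin powR_ge0.
apply: ge0_le_integral => //.
- move=> t /=; rewrite in_itv/= => /andP[t0 _].
  by rewrite lee_fin sumr_ge0// => j _; exact: phi_ge0.
- apply/measurable_EFinP; apply: measurable_sum => j; exact: measurable_phi.
- by apply: measurable_funeM.
- by move=> t /=; rewrite in_itv/= => t01; rewrite lee_fin phi_sum_le.
Qed.

Lemma ln_step n : (0 < n)%N -> n%:R * (ln n.+1%:R - ln n%:R) <= 1 :> R.
Proof.
move=> n0; have n0' : 0 < n%:R :> R by rewrite ltr0n.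
rewrite -ln_div ?posrE ?ltr0n// mulrC -ler_pdivlMr// mul1r.
have -> : n.+1%:R / n%:R = 1 + n%:R^-1 :> R.
  by rewrite -addn1 natrD; field; rewrite gt_eqF.
by apply: le_ln1Dx; rewrite (@lt_trans _ _ 0)// ?ltrN10// invr_gt0.
Qed.

(** [n^n <= e^n n!]. *)
Lemma sum_ln_le n : \sum_(j < n) (ln n%:R - ln j.+1%:R) <= n%:R :> R.
Proof.
elim: n => [|n IH]; first by rewrite big_ord0.
rewrite big_ord_recr /= subrr addr0.
case: n IH => [|n] IH; first by rewrite big_ord0.
rewrite (eq_bigr (fun j : 'I_n.+1 => (ln n.+1%:R - ln j.+1%:R) +
  (ln n.+2%:R - ln n.+1%:R) : R)); last by move=> j _; ring.
rewrite big_split /= sumr_const card_ord [leRHS]mulrSr lerD//.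
by rewrite -[leLHS]mulr_natl; exact: ln_step.
Qed.

Lemma ln_lam_le (x : R) : 0 <= x -> ln (lam x) <= x.
Proof.
move=> x0; rewrite (@le_trans _ _ (ln (1 + x)))//.
  by rewrite ler_ln ?posrE ?lam_gt0//; [rewrite addrC lam_le|lra].
by apply: le_ln1Dx; lra.
Qed.

Lemma ln_lam_le1 (x : R) : 1 <= x -> ln (lam x) <= 1 + ln x.
Proof.
move=> x1; have x0 : 0 < x by lra.
have l2 : ln 2 <= 1 :> R by rewrite -[2]/(1 + 1 : R); apply: le_ln1Dx; lra.
rewrite (@le_trans _ _ (ln (2 * x)))//; last by rewrite lnM ?posrE// lerD2r.
rewrite ler_ln ?posrE ?lam_gt0 ?mulr_gt0//.
by have := lam_le (ltW x0); lra.
Qed.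

(** The terms with [j <= n] are at most [1 + p ln (n / j)], the others at most
    [(n / j)^p]; both sums are linear in [n]. *)
Lemma ln_Lam_bound n N : (0 < n)%N ->
  ln (Lam (pw p) (pw p n) N) <= (1 + p + (p - 1)^-1) * n%:R.
Proof.
move=> n0; have p0 := p_gt0.
have nR : 0 < n%:R :> R by rewrite ltr0n.
have pn0 : 0 < pw p n by rewrite powR_gt0.
have H : ln (Lam (pw p) (pw p n) N) <= ln (Lam (pw p) (pw p n) (n + N)).
  by rewrite ler_ln ?posrE ?Lam_gt0// Lam_mono ?leq_addl ?(ltW pn0)//; exact: pw_gt0.
apply: le_trans H _; rewrite ln_Lam.
rewrite -(big_mkord xpredT (fun j => ln (lamj (pw p) (pw p n) j.+1))).
rewrite (@big_cat_nat _ _ _ n)//= ?leq_addr// !mulrDl lerD//.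
- rewrite big_mkord.
  apply: (@le_trans _ _ (\sum_(j < n) (1 + p * (ln n%:R - ln j.+1%:R)))).
    apply: ler_sum => j _.
    have -> : p * (ln n%:R - ln j.+1%:R) = ln (pw p n / pw p j.+1).
      by rewrite ln_div ?posrE ?pw_gt0// /pw !ln_powR mulrBr.
    by apply: ln_lam_le1; rewrite ler_pdivlMr ?pw_gt0// mul1r pw_mono ?(ltW p0).
  rewrite big_split /= sumr_const card_ord mul1r lerD//= -mulr_sumr.
  by rewrite ler_wpM2l ?(ltW p0)// sum_ln_le.
- apply: (@le_trans _ _ (pw p n * \sum_(n <= j < n + N) j.+1%:R `^ (- p))).
    rewrite mulr_sumr; apply: ler_sum => j _; rewrite powRN.
    by apply: ln_lam_le; rewrite divr_ge0// ltW// pw_gt0.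
  apply: le_trans (ler_wpM2l (ltW pn0) (powR_tail N p1 n0)) _.
  rewrite mulrA [leRHS]mulrC ler_wpM2r ?invr_ge0 ?subr_ge0 ?(ltW p1)//.
  rewrite -powRD; last by apply/implyP => _; rewrite gt_eqF.
  by rewrite addrC subrK powRr1.
Qed.

(** With [m = n + 1]: the layer-cake integral for [y = m^p], divided by
    [y^(1/p) = m]. The number [m^2] of factors only has to be of larger order
    than [m]. *)
Definition lam_avg (n : nat) : R :=
  n.+1%:R^-1 * (2 * ln (Lam (pw p) (pw p n.+1) (n.+1 ^ 2)%N)).

Lemma phi_avg_ge n t : 0 < t < 1 -> t * bint t <= n.+1%:R ->
  bint t - t^-1 * n.+1%:R^-1 <=
  n.+1%:R^-1 * \sum_(j < (n.+1 ^ 2)%N) phi (tau (pw p n.+1) j.+1) t.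
Proof.
move=> t01 tn; have /andP[t0 _] := t01; have p0 := p_gt0.
have n0 : 0 < n.+1%:R :> R by rewrite ltr0n.
rewrite phi_sumE ?pw_gt0//.
have -> : pw p n.+1 `^ p^-1 = n.+1%:R.
  by rewrite /pw -powRrM mulfV ?powRr1// gt_eqF.
have := count_ge (n.+1%:R * (t * bint t)) (n.+1 ^ 2)%N.
rewrite (_ : Num.min _ _ = n.+1%:R * (t * bint t) - 1); last first.
  apply/min_idPr; rewrite natrX expr2 lerBlDr.
  by have := ler_wpM2l (ltW n0) tn; lra.
set S := \sum_(j < _) _ => hS.
have -> : n.+1%:R^-1 * (S / t) = S / (t * n.+1%:R).
  by rewrite invfM [in RHS]mulrA [RHS]mulrC.
rewrite ler_pdivlMr ?mulr_gt0//; apply: le_trans hS.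
rewrite le_eqVlt; apply/orP; left; apply/eqP.
rewrite mulrBl -invfM mulVf; last by rewrite mulf_neq0// gt_eqF.
by congr (_ - _); ring.
Qed.

Lemma limn_einf_le (u : (\bar R)^nat) c N :
  (forall n, (N <= n)%N -> (u n <= c)%E) -> (limn_einf u <= c)%E.
Proof.
move=> uc; rewrite limn_einf_lim; apply: lime_le; first exact: is_cvg_einfs.
exists N => // n /= Nn; apply: le_trans (uc _ Nn).
by apply: ereal_inf_lbound; exists n => /=.
Qed.

(** The scaled layer-cake integrands converge pointwise to [bint]. Fatou's lemma
    thus bounds the beta integral by the lower limit of [lam_avg]; together with
    [ln_Lam_bound] this shows in particular that the integral is finite. *)
Lemma bint_fatou : (\int[mu]_(t in `]0%R, 1%R[) (bint t)%:E <=
  limn_einf (fun n => (lam_avg n)%:E))%E.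
Proof.
pose f n t : R := n.+1%:R^-1 * \sum_(j < (n.+1 ^ 2)%N) phi (tau (pw p n.+1) j.+1) t.
have mS n : measurable_fun (`]0, 1[%classic : set R)
    (fun t => \sum_(j < (n.+1 ^ 2)%N) phi (tau (pw p n.+1) j.+1) t).
  by apply: measurable_sum => j; exact: measurable_phi.
have S0 n t : 0 < t -> 0 <= \sum_(j < (n.+1 ^ 2)%N) phi (tau (pw p n.+1) j.+1) t.
  by move=> t0; rewrite sumr_ge0// => j _; exact: phi_ge0.
have -> : (fun n => (lam_avg n)%:E) =
    (fun n => \int[mu]_(t in `]0%R, 1%R[) (f n t)%:E)%E.
  apply/funext => n; rewrite /f; under eq_integral do rewrite EFinM.
  rewrite ge0_integralZl//.
  - by rewrite integral_phi_sum ?pw_gt0.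
  - by apply/measurable_EFinP; exact: mS.
  - by move=> t /=; rewrite in_itv/= => /andP[t0 _]; rewrite lee_fin S0.
have -> : (\int[mu]_(t in `]0%R, 1%R[) (bint t)%:E =
    \int[mu]_(t in `]0%R, 1%R[) limn_einf (fun n => (f n t)%:E))%E.
  apply: eq_integral => t; rewrite inE/= in_itv/= => t01.
  have /andP[t0 _] := t01.
  suff : (fun n => (f n t)%:E) @ \oo --> (bint t)%:E.
    by move=> /cvg_limn_einf_sup[-> _].
  apply: cvg_EFin; first exact: nearW.
  apply: (@squeeze_cvgr _ _ _ _ (fun n => bint t - t^-1 * n.+1%:R^-1) (cst (bint t))).
  - near=> n; apply/andP; split.
      apply: phi_avg_ge => //; near: n.
      exists (Num.truncn (t * bint t)) => // n /= hn.
      have /andP[_ /ltW h] := truncn_itv (mulr_ge0 (ltW t0) (bint_ge0 t)).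
      by rewrite (le_trans h)// ler_nat.
    rewrite /= /f mulrC ler_pdivrMr ?ltr0n// mulrC.
    have -> : n.+1%:R = pw p n.+1 `^ p^-1 :> R.
      by rewrite /pw -powRrM mulfV ?powRr1// gt_eqF// p_gt0.
    by rewrite phi_sum_le// pw_gt0.
  - rewrite -[X in _ --> X]subr0 -(mulr0 (t^-1)).
    apply: cvgB; first exact: cvg_cst.
    by apply: cvgM; [exact: cvg_cst|exact: cvg_harmonic].
  - exact: cvg_cst.
apply: fatou => //.
- move=> n; apply/measurable_EFinP; apply: measurable_funM => //; exact: mS.
- move=> n t /=; rewrite in_itv/= => /andP[t0 _].
  by rewrite lee_fin mulr_ge0// S0.
Unshelve. all: by end_near.
Qed.

Definition bval : R := euler_beta (2 * p)^-1 (1 - p^-1).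

Lemma bvalE : (\int[mu]_(t in `]0%R, 1%R[) (bint t)%:E = bval%:E)%E.
Proof.
rewrite /bval /euler_beta /Rintegral fineK// ge0_fin_numE; last first.
  by apply: integral_ge0 => t _; rewrite lee_fin bint_ge0.
apply: le_lt_trans bint_fatou _.
apply: le_lt_trans (ltry (2 * (1 + p + (p - 1)^-1))).
apply: (@limn_einf_le _ _ 0) => n _; rewrite lee_fin /lam_avg.
rewrite mulrC ler_pdivrMr ?ltr0n// -mulrA ler_wpM2l//.
exact: ln_Lam_bound.
Qed.

Lemma ln_Lam_le y N : 0 < y ->
  ln (Lam (pw p) y N) <= 2^-1 * bval * y `^ p^-1.
Proof.
move=> y0; have := ln_Lam_leE N y0; rewrite bvalE -EFinM lee_fin.
by set A := y `^ _; set B := ln _; lra.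
Qed.

Lemma lam_avg_ge d N : 0 < d -> exists2 n, (N <= n)%N & bval - d < lam_avg n.
Proof.
move=> d0; apply: contrapT => H.
have : (bval%:E <= (bval - d)%:E)%E.
  rewrite -bvalE; apply: le_trans bint_fatou _.
  apply: (@limn_einf_le _ _ N) => n Nn; rewrite lee_fin leNgt.
  by apply/negP => h; apply: H; exists n.
by rewrite lee_fin; lra.
Qed.

End beta.

(** * Limits of complex series *)

Import Normc.
Local Open Scope complex_scope.

Section complex_series.
Context {R : realType}.
Implicit Types (z l : R[i]) (u : nat -> R[i]^o).

Lemma normc_le_ReIm z : normc z <= `|complex.Re z| + `|complex.Im z|.
Proof.
case: z => x y /=; rewrite -(@ler_pXn2r _ 2)// ?nnegrE ?sqrtr_ge0 ?addr_ge0//.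
rewrite sqr_sqrtr ?addr_ge0 ?sqr_ge0// sqrrD !real_normK ?num_real//.
by rewrite addrAC lerDl mulrn_wge0// mulr_ge0.
Qed.

Lemma Re_le_normc z : `|complex.Re z| <= normc z.
Proof.
by case: z => x y /=; rewrite -sqrtr_sqr ler_wsqrtr// lerDl sqr_ge0.
Qed.

Lemma Im_le_normc z : `|complex.Im z| <= normc z.
Proof.
by case: z => x y /=; rewrite -sqrtr_sqr ler_wsqrtr// lerDr sqr_ge0.
Qed.

Lemma normrC z : `|z| = (normc z)%:C. Proof. by case: z. Qed.

Lemma Re_sum (I : Type) (r : seq I) (F : I -> R[i]) :
  complex.Re (\sum_(i <- r) F i) = \sum_(i <- r) complex.Re (F i).
Proof. by elim/big_rec2: _ => // i x y _ <-; case: (F i) y => ? ? []. Qed.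

Lemma Im_sum (I : Type) (r : seq I) (F : I -> R[i]) :
  complex.Im (\sum_(i <- r) F i) = \sum_(i <- r) complex.Im (F i).
Proof. by elim/big_rec2: _ => // i x y _ <-; case: (F i) y => ? ? []. Qed.

Lemma cvg_complex_series u (a b : R) :
  series (fun k => complex.Re (u k)) @ \oo --> a ->
  series (fun k => complex.Im (u k)) @ \oo --> b ->
  series u @ \oo --> (a +i* b : R[i]^o).
Proof.
move=> /cvgrPdist_lt ua /cvgrPdist_lt ub; apply/cvgrPdist_lt => e.
rewrite ltcE /= => /andP[/eqP ei er].
have e2 : 0 < complex.Re e / 2 by rewrite divr_gt0.
have {}ua := ua _ e2; have {}ub := ub _ e2.
near=> n.
have -> : e = (complex.Re e)%:C by case: (e) ei => ? ? /= ->.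
rewrite normrC ltcR (le_lt_trans (normc_le_ReIm _))//.
rewrite [complex.Re e]splitr ltrD//.
  have : `|a - series (fun k => complex.Re (u k)) n| < complex.Re e / 2 by near: n.
  by rewrite /series /= -Re_sum; case: (\sum_(_ <= _ < _) _).
have : `|b - series (fun k => complex.Im (u k)) n| < complex.Re e / 2 by near: n.
by rewrite /series /= -Im_sum; case: (\sum_(_ <= _ < _) _).
Unshelve. all: by end_near.
Qed.

Lemma normc_sum_le (I : Type) (r : seq I) (F : I -> R[i]) :
  normc (\sum_(i <- r) F i) <= \sum_(i <- r) normc (F i).
Proof.
elim/big_rec2: _ => [|i y x _ h]; first by rewrite normc0.
by rewrite (le_trans (le_normcD _ _))// lerD2l.
Qed.

(** A dominated complex series converges, by completeness of the reals for the
    real and imaginary parts; without convergence the limit in this statement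
    would be an arbitrary value. *)
Lemma limn_series_le u (m : nat -> R) (S : R) :
  (forall k, normc (u k) <= m k) -> (forall n, \sum_(k < n) m k <= S) ->
  normc (limn (series u)) <= S.
Proof.
move=> um mS.
have m0 k : 0 <= m k by apply: le_trans (um k); case: (u k) => ? ?; exact: sqrtr_ge0.
have cm : cvgn (series m).
  apply: nondecreasing_is_cvgn.
    by apply/nondecreasing_seqP => n; rewrite seriesSr lerDl.
  by exists S => _ [n _ <-]; rewrite /series /= big_mkord.
have cv (f : R[i] -> R) : (forall z, `|f z| <= normc z) ->
    cvgn (series (fun k => f (u k))).
  move=> fn; apply: normed_cvg; apply: series_le_cvg cm => // k.
    by rewrite /=.
  exact: (le_trans (fn _) (um k)).
have /cvg_ex[a ua] := cv _ Re_le_normc.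
have /cvg_ex[b ub] := cv _ Im_le_normc.
have ul := cvg_complex_series ua ub.
rewrite (cvg_lim (@norm_hausdorff _ _) ul).
apply/ler_addgt0Pr => e e0.
have eC : 0 < e%:C :> R[i] by rewrite ltcR.
move/cvgrPdist_lt : ul => /(_ _ eC)[n _ /(_ n (leqnn n))] /=.
rewrite normrC ltcR => /ltW h.
have := le_normcD ((a +i* b) - (series u n : R[i])) (series u n).
rewrite subrK => /le_trans; apply; rewrite addrC lerD//.
apply: le_trans (mS n); rewrite (le_trans (normc_sum_le _ _))// big_mkord.
by apply: ler_sum => i _.
Qed.

Lemma limn_series_real (c : R[i]) (m : nat -> R) (S : R) :
  series m @ \oo --> S ->
  limn (series (fun k => c * (m k)%:C : R[i]^o)) = c * S%:C.
Proof.
move=> mS; apply: (cvg_lim (@norm_hausdorff _ _)).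
have -> : c * S%:C = (complex.Re c * S) +i* (complex.Im c * S).
  by case: c => x y; rewrite /= [LHS]/GRing.mul /=; simpc.
apply: cvg_complex_series.
- rewrite [X in X @ _ --> _](_ : _ = fun n => complex.Re c * series m n).
    exact: cvgMl_tmp.
  apply/funext => n; rewrite /series /= mulr_sumr; apply: eq_bigr => k _.
  by case: (c) => x y /=; simpc.
- rewrite [X in X @ _ --> _](_ : _ = fun n => complex.Im c * series m n).
    exact: cvgMl_tmp.
  apply/funext => n; rewrite /series /= mulr_sumr; apply: eq_bigr => k _.
  by case: (c) => x y /=; simpc.
Qed.

End complex_series.

(** * Maximum modulus of the Nevanlinna functions *)

Section jacobi_values.
Context {R : realType}.
Variable a : nat -> R.
Hypothesis a_gt0 : forall k, 0 < a k.+1.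
Hypothesis a1 : a 1 = 1.

(** The index [true] stands for the first kind, [false] for the second kind. *)
Definition jpoly (b : bool) : nat -> {poly R[i]} :=
  if b then jacobiP a else jacobiQ a.
Definition jreal (b : bool) : R -> nat -> R := jsol a b%:R (~~ b)%:R.

Lemma jpoly0 b z : (jpoly b 0).[z] = b%:R%:C.
Proof. by case: b; rewrite /jpoly /= hornerE. Qed.

Lemma jpoly1 b z : (jpoly b 1).[z] = (~~ b)%:R%:C + b%:R%:C * z.
Proof.
case: b; rewrite /jpoly /= a1 invr1 scale1r !hornerE //.
Qed.

Lemma aC_neq0 k : (a k.+1)%:C != 0 :> R[i].
Proof. by rewrite fmorph_eq0 gt_eqF. Qed.

Lemma jpolyS b z k : (a k.+2)%:C * (jpoly b k.+2).[z] =
  z * (jpoly b k.+1).[z] - (a k.+1)%:C * (jpoly b k).[z].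
Proof.
by case: b; rewrite /jpoly [in LHS]/= hornerZ mulrA mulfV ?aC_neq0// mul1r !hornerE //.
Qed.

Lemma normc_real (x : R) : normc x%:C = `|x|.
Proof. by rewrite /= expr0n addr0 sqrtr_sqr. Qed.

Lemma normc_ge0 (z : R[i]) : 0 <= normc z.
Proof. by case: z => ? ?; exact: sqrtr_ge0. Qed.

(** The triangle inequality turns the recurrence at [z] into the one at
    [i |z|]. *)
Lemma normc_jpoly b z k : normc (jpoly b k).[z] <= jreal b (normc z) k.
Proof.
elim/jsol_ind2 : k => [||k h0 h1].
- by rewrite jpoly0 normc_real /jreal jsol0 ger0_norm.
- rewrite jpoly1 /jreal jsol1 (le_trans (le_normcD _ _))// normcM.
  by rewrite !normc_real !ger0_norm.
have E : normc ((a k.+2)%:C * (jpoly b k.+2).[z]) = a k.+2 * normc (jpoly b k.+2).[z].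
  by rewrite normcM normc_real gtr0_norm.
rewrite -(ler_pM2l (a_gt0 k.+1)) -E jpolyS /jreal jsolS//.
rewrite (le_trans (le_normcD _ _))// normcN !normcM normc_real (gtr0_norm (a_gt0 k)).
by rewrite lerD// ler_wpM2l// ?normc_ge0// ltW.
Qed.

Definition phase (b : bool) : R[i] := if b then 1 else - 'i.

Lemma jpoly_imag b (y : R) k :
  (jpoly b k).[y%:C * 'i] = phase b * 'i ^+ k * (jreal b y k)%:C.
Proof.
have ii : 'i * 'i = -1 :> R[i] by rewrite -expr2 sqr_i.
elim/jsol_ind2 : k => [||k h0 h1].
- by rewrite jpoly0 /jreal jsol0; case: b; rewrite /phase/= ?mulr1 ?mul1r// mulr0.
- rewrite jpoly1 /jreal jsol1; case: b; rewrite /phase/= expr1.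
    by rewrite rmorph0 rmorph1 !(mul1r, add0r) mulrC.
  by rewrite rmorph0 !mul0r !addr0 mulNr ii opprK mul1r.
apply: (mulfI (aC_neq0 k.+1)); rewrite jpolyS h0 h1.
rewrite [RHS]mulrCA -rmorphM /jreal jsolS// !rmorphD !rmorphM /= !exprS.
move: ('i ^+ k) => w; rewrite mulrDr.
have -> : y%:C * 'i * (phase b * ('i * w) * (jsol a b%:R (~~ b)%:R y k.+1)%:C) =
  'i * 'i * (y%:C * phase b * w * (jsol a b%:R (~~ b)%:R y k.+1)%:C) by ring.
have -> : phase b * ('i * ('i * w)) = 'i * 'i * (phase b * w) by ring.
rewrite ii; ring.
Qed.

(** At [0] the solution of the first kind lives on the even indices and the one
    of the second kind on the odd indices. *)
Lemma jreal0_parity b k : (-1) ^+ k * jreal b 0 k = (-1) ^+ (~~ b) * jreal b 0 k.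
Proof.
elim/jsol_ind2 : k => [||k h0 _].
- by rewrite /jreal jsol0; case: b; rewrite ?mulr0.
- by rewrite /jreal jsol1 mulr0 addr0; case: b; rewrite ?mulr0.
apply: (mulfI (lt0r_neq0 (a_gt0 k.+1))).
rewrite mulrCA [RHS]mulrCA /jreal jsolS// mul0r add0r mulrCA [RHS]mulrCA.
by rewrite -/(jreal b 0 k) -h0 !exprS !mulN1r opprK.
Qed.

(** All terms of the series at [i y] have the same argument: the factor
    [(-1)^k] coming from the two powers of [i] is constant on the support of
    the first sequence. *)
Lemma jpoly_term b b' y k :
  (jpoly b k).[0] * (jpoly b' k).[y%:C * 'i] =
  (phase b * phase b' * (-1) ^+ (~~ b)) * (jreal b 0 k * jreal b' y k)%:C.
Proof.
rewrite -[X in (jpoly b k).[X]](mul0r 'i) -[X in (jpoly b k).[X * _]]/(0%:C).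
rewrite !jpoly_imag.
have E : 'i ^+ k * 'i ^+ k * (jreal b 0 k)%:C =
    (-1) ^+ (~~ b) * (jreal b 0 k)%:C :> R[i].
  have -> : 'i ^+ k * 'i ^+ k = ((-1) ^+ k)%:C :> R[i].
    by rewrite -exprMn -expr2 sqr_i rmorphXn rmorphN1.
  by rewrite -rmorphM /= jreal0_parity rmorphM /= rmorphXn rmorphN1.
transitivity (phase b * phase b' * ('i ^+ k * 'i ^+ k * (jreal b 0 k)%:C) *
  (jreal b' y k)%:C); first ring.
rewrite E rmorphM /=; ring.
Qed.

(** [nev b b'] is [D], [B], [C], [A] for [(b, b')] equal to [(true, true)],
    [(false, true)], [(true, false)], [(false, false)]. *)
Definition nev_cst (b b' : bool) : R[i] :=
  if b then (if b' then 0 else 1) else (if b' then -1 else 0).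
Definition nev (b b' : bool) (z : R[i]) : R[i] := nev_cst b b' +
  z * limn (series (fun k => (jpoly b k).[0] * (jpoly b' k).[z] : R[i]^o)).

(** The constant term of [nev b b'] is [theta b b' * kap b b'], and the terms of
    its series at [i y] are nonnegative multiples of [theta b b' / i]. *)
Definition kap (b b' : bool) : R := b%:R * (~~ b')%:R + (~~ b)%:R * b'%:R.
Definition theta (b b' : bool) : R[i] := 'i * (phase b * phase b' * (-1) ^+ (~~ b)).

Lemma thetaE b b' : theta b b' = if b == b' then 'i else if b then 1 else -1.
Proof.
have ii : 'i * 'i = -1 :> R[i] by rewrite -expr2 sqr_i.
rewrite /theta; case: b; case: b'; rewrite /phase /= ?expr0 ?expr1 ?mulr1 ?mul1r//.
- by rewrite mulrN ii opprK.
- by rewrite mulrN1 opprK ii.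
- by rewrite mulrNN ii mulN1r opprK mulr1.
Qed.

Lemma normc_theta b b' : normc (theta b b') = 1.
Proof.
rewrite thetaE; case: ifP => _; last case: ifP => _; rewrite ?normcN ?normc1//.
by rewrite /= expr0n add0r expr1n sqrtr1.
Qed.

Lemma nev_cstE b b' : nev_cst b b' = theta b b' * (kap b b')%:C.
Proof.
rewrite thetaE /nev_cst /kap; case: b; case: b' => /=.
- by rewrite mulr0 mul0r addr0 mulr0.
- by rewrite mulr1 mul0r addr0 mulr1.
- by rewrite mulr1 mul0r add0r mulr1.
- by rewrite mulr0 mul0r addr0 mulr0.
Qed.

(** The maximum over the circle is attained at [i r]: there all the terms have
    the same argument and each has its largest possible modulus. *)
Lemma max_modulus_nev b b' (r S : R) : 0 <= r ->
  series (fun k => jreal b 0 k * jreal b' r k) @ \oo --> S ->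
  max_modulus (nev b b') r = (kap b b' + r * S)%:E.
Proof.
move=> r0 hS.
have t0 k : 0 <= jreal b 0 k * jreal b' r k by rewrite mulr_ge0// bsol_ge0.
have SS n : \sum_(k < n) (jreal b 0 k * jreal b' r k) <= S.
  rewrite -(big_mkord xpredT (fun k => jreal b 0 k * jreal b' r k)).
  rewrite -(cvg_lim (@Rhausdorff _) hS); apply: nondecreasing_cvgn_le.
    by apply/nondecreasing_seqP => m; rewrite seriesSr lerDl.
  by apply/cvg_ex; exists S.
have S0 : 0 <= S by have := SS 0; rewrite big_ord0.
have k0 : 0 <= kap b b' by rewrite addr_ge0// mulr_ge0.
apply/eqP; rewrite eq_le; apply/andP; split.
  apply: ge_ereal_sup => _ [z /= zr <-]; rewrite lee_fin.
  rewrite (le_trans (le_normcD _ _))// nev_cstE (normcM (theta _ _)).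
  rewrite normc_theta mul1r (normcM z).
  rewrite normc_real ger0_norm// lerD2l zr ler_wpM2l//.
  apply: (@limn_series_le _ _ (fun k => jreal b 0 k * jreal b' r k)) => // k.
  rewrite normcM ler_pM ?normc_ge0//; last by rewrite -zr normc_jpoly.
  by rewrite (le_trans (normc_jpoly _ _ _))// normc0.
apply: ereal_sup_ubound; exists (r%:C * 'i).
  change (normc (r%:C * 'i) = r).
  by rewrite normcM normc_real ger0_norm// /= expr0n add0r expr1n sqrtr1 mulr1.
rewrite /nev (_ : (fun k => _) = (fun k => (phase b * phase b' * (-1) ^+ (~~ b)) *
  (jreal b 0 k * jreal b' r k)%:C : R[i]^o)); last first.
  by apply/funext => k; exact: jpoly_term.
rewrite (limn_series_real _ hS) nev_cstE.
have -> : r%:C * 'i * (phase b * phase b' * (-1) ^+ (~~ b) * S%:C) =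
  theta b b' * (r * S)%:C by rewrite rmorphM /theta /=; ring.
rewrite -mulrDr -rmorphD normcM normc_theta mul1r normc_real ger0_norm//.
by rewrite addr_ge0// mulr_ge0.
Qed.

End jacobi_values.

(** * Order and type *)

Section assembly.
Context {R : realType}.
Variable p : R.
Hypothesis p1 : 1 < p.
Local Notation a := (pw p).
Let p_gt0' : 0 < p := p_gt0 p1.

(** In the variable [s = r^(1/(2p))] the logarithm of [r] is at most [2 p s],
    while [r^(-1/p) = s^-2]. *)
Lemma log_negligible (A B d : R) : 0 < d ->
  exists2 r0, 1 <= r0 & forall r, r0 <= r -> r `^ (- p^-1) * (A + B * ln r) <= d.
Proof.
move=> d0; pose e := (2 * p)^-1.
have e0 : 0 < e by rewrite invr_gt0 mulr_gt0.
pose c := `|A| + `|B| * (2 * p).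
have c0 : 0 <= c by rewrite addr_ge0// !mulr_ge0// ltW.
pose s0 := Num.max 1 (c / d).
have s1 : 1 <= s0 by rewrite le_max lexx.
exists (s0 `^ (2 * p)).
  by rewrite -[leLHS](powRr0 s0) ler_powR ?mulr_ge0 ?(ltW p_gt0').
move=> r rr; have s00 : 0 < s0 by apply: lt_le_trans s1.
have r0 : 0 < r by apply: lt_le_trans rr; rewrite powR_gt0.
pose s := r `^ e.
have ss : s0 <= s.
  rewrite -[leLHS]powRr1 ?(ltW s00)// -[1](@mulfV _ (2 * p)) ?mulf_neq0 ?gt_eqF//.
  rewrite powRrM ge0_ler_powR ?nnegrE ?powR_ge0 ?(ltW e0)// ltW//.
have sp : 0 < s by apply: lt_le_trans ss.
have -> : r `^ (- p^-1) = (s ^+ 2)^-1.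
  rewrite powRN -powR_mulrn ?powR_ge0// -powRrM; congr (_ `^ _)^-1.
  by rewrite /e; field; rewrite gt_eqF.
have lr : ln r = 2 * p * ln s.
  by rewrite /s ln_powR mulrA mulfV ?mul1r// mulf_neq0// gt_eqF.
rewrite mulrC ler_pdivrMr ?exprn_gt0//.
have ls : 0 <= ln s <= s.
  by rewrite ln_ge0 ?(le_trans s1 ss)//= ltW// ln_sublinear.
have h1 : A <= `|A| * s.
  rewrite (le_trans (ler_norm _))// ler_peMr//; exact: le_trans s1 ss.
have h2 : B * ln r <= `|B| * (2 * p) * s.
  rewrite lr mulrA (@le_trans _ _ (`|B| * (2 * p) * ln s))//.
    by rewrite ler_wpM2r ?ler_wpM2r ?ler_norm ?mulr_ge0 ?(ltW p_gt0')//; case/andP: ls.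
  by rewrite ler_wpM2l ?mulr_ge0 ?(ltW p_gt0')//; case/andP: ls.
have h3 : c <= d * s by rewrite mulrC -ler_pdivrMr// (le_trans _ ss)// le_max lexx orbT.
have h4 := ler_wpM2r (ltW sp) h3.
rewrite (@le_trans _ _ (c * s))//; last by rewrite expr2 mulrA.
by rewrite /c mulrDl lerD.
Qed.

Lemma limf_esup_eq (G : R -> \bar R) (F : R -> R) (l : R) :
  (forall r, 1 <= r -> G r = (F r)%:E) ->
  (forall d, 0 < d -> exists r0, forall r, r0 <= r -> F r <= l + d) ->
  (forall d r0, 0 < d -> exists2 r, r0 <= r & l - d <= F r) ->
  limf_esup G +oo = l%:E.
Proof.
move=> GF up lo; apply/eqP; rewrite eq_le; apply/andP; split.
  apply/lee_addgt0Pr => d d0; have [r0 hr0] := up _ d0.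
  rewrite limf_esupE.
  apply: (@le_trans _ _ (ereal_sup (G @` [set r | Num.max r0 1 < r]))).
    apply: ereal_inf_lbound; exists [set r | Num.max r0 1 < r] => //=.
    by exists (Num.max r0 1); split => //; rewrite num_real.
  apply: ge_ereal_sup => _ [r /= + <-]; rewrite gt_max => /andP[/ltW h1 /ltW h2].
  by rewrite GF// -EFinD lee_fin hr0.
rewrite limf_esupE; apply: le_ereal_inf_tmp => _ [V [M [_ MV]] <-].
apply/lee_subgt0Pr => d d0.
have [r rM hr] := lo _ (Num.max (M + 1) 1) d0.
move: rM; rewrite ge_max => /andP[rM r1].
apply: (@le_trans _ _ (G r)); first by rewrite GF// -EFinB lee_fin.
by apply: ereal_sup_ubound; exists r => //; apply: MV; rewrite (lt_le_trans _ rM)// ltrDl.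
Qed.

Let a0 := @pw_gt0 R p.
Let a1 := @pw1 R p.
Let am k : a k.+1 <= a k.+2 := @pw_mono R p _ _ (ltW p_gt0') (leqnSn k.+1).

Lemma series_wr b b' (r : R) n : 
  kap b b' + r * series (fun k => jreal a b 0 k * jreal a b' r k) n.+1 =
  wr a (jreal a b 0) (jreal a b' r) n.
Proof.
rewrite /jreal (wr_sum a0 a1) /kap /series /= big_mkord; congr (_ + _).
Qed.

(** The maximum modulus is the limit of the nondecreasing Casoratians, so the
    two-sided estimates of these pass to it. *)
Lemma max_modulus_bounds b b' : exists (M : R -> R) (C D E : R),
  [/\ 0 < C, 0 < E & forall r, 1 <= r -> [/\ 0 < M r,
   max_modulus (nev a b b') r = (M r)%:E,
   M r <= C * r `^ D * expR (2^-1 * bval p * r `^ p^-1) &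
   forall n, Lam a r n <= E * n.+2%:R `^ p * M r]].
Proof.
have [C [D [C0 D0 W]]] := wr_upper_pw p1.
pose S r := limn (series (fun k => jreal a b 0 k * jreal a b' r k)).
exists (fun r => kap b b' + r * S r), C, D, 2; split => // r r1.
have r0 : 0 < r by apply: lt_le_trans r1.
set B := C * _ * _.
have wB n : wr a (jreal a b 0) (jreal a b' r) n <= B.
  have [K h] := W b b' r n r1; apply: (le_trans h).
  rewrite ler_wpM2l ?mulr_ge0 ?powR_ge0 ?(ltW C0)//.
  rewrite -[leLHS]lnK ?posrE ?Lam_gt0// ler_expR.
  exact: ln_Lam_le.
have t0 k : 0 <= jreal a b 0 k * jreal a b' r k.
  by rewrite mulr_ge0// (bsol_ge0 a0)// ltW.
have k0 : 0 <= kap b b' :> R by rewrite addr_ge0// mulr_ge0.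
have nd : nondecreasing_seq (series (fun k => jreal a b 0 k * jreal a b' r k)).
  by apply/nondecreasing_seqP => n; rewrite seriesSr lerDl.
have sB n : series (fun k => jreal a b 0 k * jreal a b' r k) n <= B / r.
  apply: (le_trans (nd _ _ (leqnSn n))).
  rewrite ler_pdivlMr// mulrC (le_trans _ (wB n))// -series_wr lerDr//.
have cS : series (fun k => jreal a b 0 k * jreal a b' r k) @ \oo --> S r.
  by apply: nondecreasing_is_cvgn => //; exists (B / r) => _ [n _ <-].
have wM n : wr a (jreal a b 0) (jreal a b' r) n <= kap b b' + r * S r.
  rewrite -series_wr lerD2l ler_wpM2l ?(ltW r0)//.
  by apply: nondecreasing_cvgn_le => //; apply/cvg_ex; exists (S r).
have LM n : Lam a r n <= 2 * n.+2%:R `^ p * (kap b b' + r * S r).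
  have [m h] := wr_lower a0 a1 am b b' n r1; apply: (le_trans h).
  by rewrite ler_wpM2l// ?mulr_ge0// powR_ge0.
split => //.
- have := lt_le_trans (Lam_gt0 a r 0) (LM 0).
  by rewrite pmulr_rgt0// mulr_gt0// powR_gt0.
- by apply: max_modulus_nev => //; exact: ltW.
rewrite -lerBrDl -ler_pdivlMl// limr_le//.
apply: nearW => n; rewrite ler_pdivlMl// lerBrDl.
by rewrite (le_trans _ (wB n))// -series_wr lerD2l ler_wpM2l ?(ltW r0)// nd.
Qed.

Lemma sqr_add2_le n : ((n.+1 ^ 2).+2 <= 3 * (n.+1 * n.+1))%N.
Proof. by lia. Qed.

(** The lower bound for the upper limit needs only radii tending to infinity;
    those of the form [n^p] are used, with [n^2] factors in [Lam]. *)
Lemma exp_type_nev b b' : exp_type p^-1 (nev a b b') = (2^-1 * bval p)%:E.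
Proof.
have [M [C [D [E [C0 E0 H]]]]] := max_modulus_bounds b b'.
apply: (@limf_esup_eq _ (fun r => r `^ (- p^-1) * ln (M r))).
- by move=> r r1; have [M0 -> _ _] := H r r1; rewrite lne_EFin// -EFinM.
- move=> d d0; have [r0 r01 hr0] := log_negligible (ln C) D d0.
  exists r0 => r rr0; have r1 := le_trans r01 rr0.
  have rp : 0 < r by apply: lt_le_trans r1.
  have [M0 _ Mu _] := H r r1.
  have : ln (M r) <= ln C + D * ln r + 2^-1 * bval p * r `^ p^-1.
    rewrite -ln_powR -lnM ?posrE ?powR_gt0// -[X in _ + X]expRK.
    rewrite -lnM ?posrE ?expR_gt0 ?mulr_gt0 ?powR_gt0//.
    by rewrite ler_ln ?posrE// !mulr_gt0 ?powR_gt0 ?expR_gt0.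
  move=> /(ler_wpM2l (powR_ge0 r (- p^-1))) /le_trans; apply.
  rewrite mulrDr addrC lerD ?hr0// mulrCA powRN mulVf ?mulr1//.
  by rewrite gt_eqF// powR_gt0.
move=> d r0 d0.
have d2 : 0 < d / 2 by rewrite divr_gt0.
have [r1 r11 hr1] := log_negligible (ln (E * 3 `^ p)) 2 d2.
have [n nN hn] := lam_avg_ge p1 (Num.truncn (Num.max r0 r1)) d0.
have rge : Num.max r0 r1 <= a n.+1.
  have x0 : 0 <= Num.max r0 r1 by rewrite le_max (le_trans _ r11) ?orbT.
  have /andP[_ /ltW h] := truncn_itv x0; apply: (le_trans h).
  apply: (@le_trans _ _ n.+1%:R); first by rewrite ler_nat.
  rewrite -[leLHS]powRr1// /pw ler_powR ?ler1n//; exact: ltW.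
move: rge; rewrite ge_max => /andP[rge0 rge1].
exists (a n.+1) => //.
have r1n := le_trans r11 rge1.
have [M0 _ _ Ml] := H _ r1n.
have {}hr1 := hr1 _ rge1.
have aV : a n.+1 `^ (- p^-1) = n.+1%:R^-1.
  by rewrite powRN /pw -powRrM mulfV ?powRr1// gt_eqF.
have L : ln (Lam a (a n.+1) (n.+1 ^ 2)%N) <=
    (ln (E * 3 `^ p) + 2 * ln (a n.+1)) + ln (M (a n.+1)).
  have h := Ml (n.+1 ^ 2)%N.
  have g : (n.+1 ^ 2).+2%:R `^ p <= 3 `^ p * a n.+1 ^+ 2.
    rewrite /pw expr2 -!powRM// ge0_ler_powR ?nnegrE ?(ltW p_gt0')// ?mulr_ge0//.
    by rewrite -!natrM ler_nat sqr_add2_le.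
  have {}h : Lam a (a n.+1) (n.+1 ^ 2)%N <=
      (E * 3 `^ p) * (a n.+1 ^+ 2) * M (a n.+1).
    by rewrite (le_trans h)// ler_wpM2r ?(ltW M0)// -mulrA ler_wpM2l// ltW.
  rewrite -ler_ln ?posrE ?Lam_gt0// in h; last first.
    by rewrite !mulr_gt0 ?exprn_gt0 ?powR_gt0.
  apply: (le_trans h).
  rewrite lnM ?posrE// ?lnM ?posrE ?mulr_gt0 ?exprn_gt0 ?powR_gt0//.
  by rewrite [2 * _]mulr_natl mulr2n.
move: hn hr1; rewrite /lam_avg aV mulrCA.
have nV : 0 <= n.+1%:R^-1 :> R by rewrite invr_ge0.
move: (ler_wpM2l nV L); rewrite mulrDr.
set x := _ * ln (Lam _ _ _); set y := _ * (_ + _); set z := _ * ln (M _).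
move: x y z => x y z; lra.
Qed.

End assembly.

Theorem mainTheorem2 (R : realType) (p : R) (hp : 1 < p) :
  let a := fun j : nat => j%:R `^ p in
  let sigma := (2^-1 * euler_beta (2 * p)^-1 (1 - p^-1))%:E in
  [/\ exp_type p^-1 (nevanlinnaA a) = sigma,
      exp_type p^-1 (nevanlinnaB a) = sigma,
      exp_type p^-1 (nevanlinnaC a) = sigma &
      exp_type p^-1 (nevanlinnaD a) = sigma].
Proof.
move=> a sigma.
have T b b' : exp_type p^-1 (nev a b b') = sigma by exact: exp_type_nev.
have E0 b : (fun z : R[i] => z * limn (series (fun k =>
    (jpoly a b k).[0] * (jpoly a b k).[z] : R[i]^o))) = nev a b b.
  by apply/funext => z; rewrite /nev /nev_cst; case: b; rewrite add0r.
split.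
- by rewrite -(T false false) -E0.
- exact: (T false true).
- exact: (T true false).
- by rewrite -(T true true) -E0.
Qed.
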